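(* Let $T$ be a $\mu$-invariant Markov kernel on $(E,\mathscr{E})$ which is $\mu$-irreducible. Then $T$ possesses a $\|\cdot\|_{\mathrm{osc}}^2$-WPI. Moreover, if $\mathrm{ess}_\mu\inf_xT(x,\{x\})>0$, then $T^*T$ possesses a $\|\cdot\|_{\mathrm{osc}}^2$-WPI and $T$ is $\|\cdot\|_{\mathrm{osc}}^2$-convergent.
   Context: $(E,\mathscr{E})$ is a measurable space with measurable diagonal, $\mu$ a probability measure on it. $L^2_0(\mu)$ is the set of real $f\in L^2(\mu)$ with $\mu(f)=0$; $\|f\|_{\mathrm{osc}}=\mathrm{ess}_\mu\sup f-\mathrm{ess}_\mu\inf f\in[0,\infty]$; for a bounded operator $S$ on $L^2(\mu)$, $S^*$ is its adjoint and $\mathcal{E}(S,f)=\langle(\mathrm{Id}-S)f,f\rangle$. $\|\cdot\|_{\mathrm{osc}}^2$-WPI for $S$: there is a decreasing (non-increasing) $\alpha:(0,\infty)\to[0,\infty)$ with $\|f\|_2^2\le\alpha(r)\mathcal{E}(S,f)+r\|f\|_{\mathrm{osc}}^2$ for all $r>0$ and $f\in L^2_0(\mu)$. $T$ is $\mu$-irreducible if for any $A\in\mathscr{E}$ with $\mu(A)>0$, $\sum_{n=0}^\infty\lambda^nT^n(x,A)>0$ for all $x\in E$, for some (and hence all) $0<\lambda<1$. $T$ is $\|\cdot\|_{\mathrm{osc}}^2$-convergent if there is $\gamma:\mathbb{N}\to[0,\infty)$ decreasing with $\gamma(n)\to0$ such that $\|T^nf\|_2^2\le\gamma(n)\|f\|_{\mathrm{osc}}^2$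 for all $n\in\mathbb{N}$ and all $f\in L^2_0(\mu)$. *)

(* Defs.v *)
From HB Require Import structures.
From mathcomp Require Import all_boot all_order all_algebra.
From mathcomp Require Import all_classical all_reals all_analysis.
From mathcomp Require Import ess_sup_inf hoelder kernel.

Set Implicit Arguments.
Unset Strict Implicit.
Unset Printing Implicit Defensive.
Import Order.TTheory GRing.Theory Num.Theory.
Import numFieldNormedType.Exports.

Local Open Scope classical_set_scope.
Local Open Scope ring_scope.

(** Elements of [L^2(mu)] are represented by functions [f : E -> R] with
    [f \in Lfun mu 2%:E], and operators on [L^2(mu)] by maps
    [(E -> R) -> (E -> R)]; only their values on [L^2(mu)], up to [mu]-almost
    everywhere equality, matter. *)
Section WPI.
Context d (E : measurableType d) (R : realType).
Variable mu : probability E R.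

Definition L20 : set (E -> R) :=
  [set f | f \in Lfun mu 2%:E /\ \int[mu]_x f x = 0].

Definition inner2 (f g : E -> R) : R := \int[mu]_x (f x * g x).

Definition sqnorm2 (f : E -> R) : \bar R := ('N[mu]_2%:E[EFin \o f] ^+ 2)%E.

(** For [f \in L20] the subtraction never has the form [+oo - +oo]. *)
Definition osc (f : E -> R) : \bar R :=
  (ess_sup mu (EFin \o f) - ess_inf mu (EFin \o f))%E.

Definition dirichlet (S : (E -> R) -> (E -> R)) (f : E -> R) : R :=
  inner2 (f \- S f) f.

Definition is_adjoint (S S' : (E -> R) -> (E -> R)) : Prop :=
  (forall g, g \in Lfun mu 2%:E -> S' g \in Lfun mu 2%:E) /\
  (forall f g, f \in Lfun mu 2%:E -> g \in Lfun mu 2%:E ->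
     inner2 (S f) g = inner2 f (S' g)).

(** Two adjoints of the same operator agree [mu]-almost everywhere on every
    element of [L^2(mu)], so the choice made by [get] is immaterial; an adjoint
    exists whenever [S] is a bounded operator on [L^2(mu)]. *)
Definition adjoint (S : (E -> R) -> (E -> R)) : (E -> R) -> (E -> R) :=
  get [set S' | is_adjoint S S'].

(** Only the restriction of [alpha] to [`]0, +oo[] is meaningful. *)
Definition osc_WPI (S : (E -> R) -> (E -> R)) : Prop :=
  exists alpha : R -> R,
    [/\ forall r : R, 0 < r -> 0 <= alpha r,
        forall r s : R, 0 < r -> r <= s -> alpha s <= alpha r &
        forall (r : R) f, 0 < r -> L20 f ->
          (sqnorm2 f <= (alpha r * dirichlet S f)%:E + r%:E * osc f ^+ 2)%E].

(** With the convention [0 * +oo = 0] in [\bar R], a vanishing [gamma n]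
    forces [S^n f = 0] for unbounded [f] as well; by density of the bounded
    functions this is no additional constraint on a bounded operator. *)
Definition osc_convergent (S : (E -> R) -> (E -> R)) : Prop :=
  exists gamma : nat -> R,
    [/\ forall n, 0 <= gamma n,
        forall m n, (m <= n)%N -> gamma n <= gamma m,
        gamma n @[n --> \oo] --> 0 &
        forall n f, L20 f ->
          (sqnorm2 (iter n S f) <= (gamma n)%:E * osc f ^+ 2)%E].

End WPI.

Section markov_kernel.
Context d (E : measurableType d) (R : realType).
Variables (mu : probability E R) (T : R.-pker E ~> E).

(** The value of [kernel_op f x] is arbitrary when [f] is not [T x]-integrable;
    for [f] in [L^2(mu)] and [T] preserving [mu] this concerns a [mu]-null set
    of points [x]. *)
Definition kernel_op (f : E -> R) (x : E) : R := \int[T x]_y f y.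

Fixpoint kernel_pow (n : nat) : R.-spker E ~> E :=
  if n is m.+1 then mkcomp_noparam T (kernel_pow m)
  else kdirac (@measurable_id _ E setT).

Definition kernel_invariant : Prop :=
  forall A : set E, measurable A -> (\int[mu]_x T x A = mu A)%E.

(** Since [T^n(x, A) >= 0], the condition does not depend on [lambda]. *)
Definition kernel_irreducible : Prop :=
  forall A : set E, measurable A -> (0 < mu A)%E ->
  exists2 lambda : R, 0 < lambda < 1 &
    forall x, (0 < \sum_(0 <= n <oo) (lambda ^+ n)%:E * kernel_pow n x A)%E.

End markov_kernel.

(* Main.v *)
(* Let D_k(f) denote the integral of (f(x) - f(y))^2 against mu(dx) k(x, dy), so
   that D_T(f) = 2 E(T, f) and D_{T^n} is bounded by a multiple of D_T.  If the
   WPI failed at some r, there would be mean-zero f_k with |f_k| <= 1 and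
   ||f_k||^2 >= r, and with D_T(f_k), hence every D_{T^n}(f_k), summable in k.
   Then for some x and all n the series G(y) of the (f_k(x) - f_k(y))^2 is finite
   T^n(x, .)-almost everywhere.  Irreducibility makes mu absolutely continuous
   with respect to the sum of the measures lambda^n T^n(x, .), so G is finite
   mu-almost everywhere and f_k(x)^2 + ||f_k||^2 tends to 0 by dominated
   convergence, a contradiction.
   When T(x, {x}) >= c, the drop ||f||^2 - ||T f||^2 = E(T^* T, f) dominates
   2 E(T, f) / (1 + 1/c), which transfers the WPI to T^* T; iterating it gives
   ||T^n f||^2 <= ((1 - 1/C)^n + r) ||f||_osc^2. *)

Require Import Defs.
From HB Require Import structures.
From mathcomp Require Import all_boot all_order all_algebra.
From mathcomp Require Import all_classical all_reals all_analysis.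
From mathcomp Require Import ess_sup_inf hoelder kernel.
From mathcomp Require Import measurable_realfun ring lra.

Set Implicit Arguments.
Unset Strict Implicit.
Unset Printing Implicit Defensive.
Import Order.TTheory GRing.Theory Num.Theory.
Import numFieldNormedType.Exports.

Local Open Scope classical_set_scope.
Local Open Scope ring_scope.

(** * Square-integrable functions and variances *)

Section square_integrable.
Context d (E : measurableType d) (R : realType).
Implicit Types (mu P : {measure set E -> \bar R}).
Implicit Types (f g : E -> R).

Lemma Lfun_measurable mu p f : f \in Lfun mu p -> measurable_fun setT f.
Proof. by rewrite inE => /andP[+ _]; rewrite inE. Qed.

(** The square in [\bar R] and the real power 2 are reconciled by cases, an infinite norm included,
    so [f] may be arbitrary. *)
Lemma sqr_Lnorm2E mu f :
  ('N[mu]_2%:E[EFin \o f] ^+ 2 = \int[mu]_x (f x ^+ 2)%:E)%E.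
Proof.
have -> : ('N[mu]_2%:E[EFin \o f] ^+ 2 = 'N[mu]_2%:E[EFin \o f] `^ 2)%E.
  have := Lnorm_ge0 mu 2%:E (EFin \o f).
  case: ('N[mu]_2%:E[EFin \o f])%E => [r| |] //.
  - by rewrite lee_fin => r0; rewrite expe2 -EFinM poweR_EFin powR_mulrn// expr2.
  - by move=> _; rewrite expe2 mulyy poweRyr.
rewrite powR_Lnorm//; apply: eq_integral => x _ /=.
by rewrite powR_mulrn// real_normK// num_real.
Qed.

Lemma LfunP2 mu f : f \in Lfun mu 2%:E <->
  measurable_fun setT f /\ (\int[mu]_x (f x ^+ 2)%:E < +oo)%E.
Proof.
split => [f2|[mf fi]].
  split; first exact: Lfun_measurable f2.
  by have /integrable_lty := Lfun2_integrable_sqr f2; apply.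
rewrite inE; apply/andP; split; rewrite inE//=.
rewrite /finite_norm.
move: fi; rewrite -sqr_Lnorm2E.
have := Lnorm_ge0 mu 2%:E (EFin \o f).
by case: ('N[mu]_2%:E[EFin \o f])%E => [r| |] //; rewrite ?ltry// expe2 mulyy.
Qed.

Lemma Lfun2_integrable_mul mu f g : f \in Lfun mu 2%:E -> g \in Lfun mu 2%:E ->
  mu.-integrable setT (EFin \o (fun x => f x * g x)).
Proof. by move=> f2 g2; exact/Lfun1_integrable/(Lfun2_mul_Lfun1 f2 g2). Qed.

Lemma Lfun2_integrable P f : P setT = 1%E -> f \in Lfun P 2%:E ->
  P.-integrable setT (EFin \o f).
Proof.
by move=> PT f2; apply/Lfun1_integrable/Lfun_subset12 => //; rewrite PT.
Qed.

Lemma bounded_Lfun2 P f (b : R) : P setT = 1%E ->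
  measurable_fun setT f -> (forall x, `|f x| <= b) ->
  f \in Lfun P 2%:E.
Proof.
move=> PT mf fb; apply/LfunP2; split => //.
apply: (@le_lt_trans _ _ (\int[P]_x (b ^+ 2)%:E)%E).
  apply: ge0_le_integral => //.
  - by move=> x _; rewrite lee_fin sqr_ge0.
  - exact/measurable_EFinP/measurable_funX.
  - by move=> x _; rewrite lee_fin -real_normK ?num_real// lerXn2r ?nnegrE//
      (le_trans _ (fb x)).
by rewrite integral_cst// PT mule1 ltry.
Qed.

(** Applied with [a] the mean of [f] (variance), with [a = f x] under [T x] (inner energy), and with
    [a = f k x] under [mu] (the limit that refutes summability). *)
Lemma integral_sqrB P a f : P setT = 1%E -> f \in Lfun P 2%:E ->
  (\int[P]_y ((a - f y) ^+ 2)%:E =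
   (a ^+ 2 - 2 * a * \int[P]_y f y + \int[P]_y (f y ^+ 2))%:E)%E.
Proof.
move=> PT f2.
have if1 := Lfun2_integrable PT f2.
have if2 := Lfun2_integrable_sqr f2.
have ic c : P.-integrable setT (EFin \o fun=> c).
  by apply/Lfun1_integrable/Lfun_subset12; rewrite ?PT//; exact: (bounded_Lfun2 PT).
have iaf : P.-integrable setT (EFin \o (fun y => 2 * a * f y)).
  exact: (integrableZl measurableT (2 * a) if1).
have h : P.-integrable setT (EFin \o (fun y => a ^+ 2 - 2 * a * f y)).
  exact: (integrableB measurableT (ic _) iaf).
transitivity (\int[P]_y (a ^+ 2 - 2 * a * f y + f y ^+ 2))%:E.
  rewrite fineK; last by apply: integrable_fin_num => //; exact: integrableD h if2.
  by apply: eq_integral => y _; congr _%:E; ring.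
by rewrite RintegralD// RintegralB// Rintegral_cst// RintegralZl// PT mulr1.
Qed.

(** The difference of the two sides is the variance of [f] under [P]. *)
Lemma sqr_Rintegral_le P f : P setT = 1%E -> f \in Lfun P 2%:E ->
  (\int[P]_y f y) ^+ 2 <= \int[P]_y (f y ^+ 2).
Proof.
move=> PT f2; rewrite -subr_ge0 -lee_fin.
set m := \int[P]_y f y.
have -> : (\int[P]_y (f y ^+ 2) - m ^+ 2)%:E =
    (\int[P]_y ((m - f y) ^+ 2)%:E)%E.
  by rewrite integral_sqrB//; congr _%:E; rewrite -/m; ring.
by apply: integral_ge0 => y _; rewrite lee_fin sqr_ge0.
Qed.

(** An infinite second moment makes the bound trivial, whatever default the real integral takes;
    hence it can be used under [T x] at every [x], without an exceptional set. *)
Lemma sqr_integral_le P f : P setT = 1%E -> measurable_fun setT f ->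
  (((\int[P]_y f y) ^+ 2)%:E <= \int[P]_y (f y ^+ 2)%:E)%E.
Proof.
move=> PT mf; have [fi|] := ltP (\int[P]_y (f y ^+ 2)%:E)%E +oo%E; last first.
  by rewrite leye_eq => /eqP ->; rewrite leey.
have f2 : f \in Lfun P 2%:E by exact/LfunP2.
rewrite -[leRHS]fineK ?lee_fin ?sqr_Rintegral_le//.
exact: integrable_fin_num (Lfun2_integrable_sqr f2).
Qed.

End square_integrable.

(** * Monotone convergence and integration against mixtures of kernels *)

Lemma nd_ge0_cvg_integral d (T : measurableType d) (R : realType)
    (mu : {measure set T -> \bar R}) (g : (T -> \bar R)^nat) (h : T -> \bar R) :
  (forall n, measurable_fun setT (g n)) -> (forall n x, 0 <= g n x)%E ->
  (forall x, nondecreasing_seq (g ^~ x)) -> (forall x, g ^~ x @ \oo --> h x) ->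
  (\int[mu]_x g n x @[n --> \oo] --> \int[mu]_x h x)%E.
Proof.
move=> mg g0 ndg gh.
rewrite (eq_integral (fun x => limn (g ^~ x))).
  by apply: cvg_monotone_convergence => // x _; exact: ndg.
by move=> x _; apply/esym/cvg_lim => //; exact: gh.
Qed.

Section kernel_integral.
Context d d' (E : measurableType d) (F : measurableType d') (R : realType).
Local Open Scope ereal_scope.
Import HBNNSimple.

Lemma ge0_measurable_kernel_integral (k : R.-ker E ~> F) (h : F -> \bar R) :
  (forall y, 0 <= h y) -> measurable_fun setT h ->
  measurable_fun setT (fun x => \int[k x]_y h y).
Proof.
by move=> h0 mh; apply: measurable_fun_integral_kernel => // U /measurable_kernel.
Qed.

Variables (mu : {measure set E -> \bar R}) (k : R.-ker E ~> F).
Variables (w : E -> R) (nu : {measure set F -> \bar R}).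
Hypotheses (w0 : forall x, (0 <= w x)%R) (mw : measurable_fun setT w).
Hypothesis nuE : forall A, measurable A -> nu A = \int[mu]_x ((w x)%:E * k x A).

Let w0E x : 0 <= (w x)%:E. Proof. by rewrite lee_fin. Qed.

Let mwE : measurable_fun setT (EFin \o w). Proof. exact/measurable_EFinP. Qed.

Let integral_mixture_nnsfun (f : {nnsfun F >-> R}) :
  \int[nu]_y (f y)%:E = \int[mu]_x ((w x)%:E * \int[k x]_y (f y)%:E).
Proof.
have mfr r : measurable (f @^-1` [set r]) by exact: measurable_sfunP.
have fr0 r (m : {measure set F -> \bar R}) :
    0 <= r%:E * m (f @^-1` [set r]).
  by have := mulemu_ge0 (mu := m) (fun r => f @^-1` [set r]); apply;
    exact: preimage_nnfun0.
have fE (m : {measure set F -> \bar R}) :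
    \int[m]_y (f y)%:E = \sum_(r \in range f) r%:E * m (f @^-1` [set r]).
  under eq_integral do rewrite fimfunE -fsumEFin//.
  rewrite ge0_integral_fsum//; last 2 first.
  - by move=> r; exact/measurable_EFinP/measurableT_comp.
  - by move=> r z _; rewrite EFinM nnfun_muleindic_ge0.
  apply: eq_fsbigr => r _.
  rewrite (integralZl_indic _ (fun r => f @^-1` [set r]))//.
    by rewrite integral_indic// setIT.
  by move=> r0; rewrite preimage_nnfun0.
rewrite fE; under [RHS]eq_integral => x _.
  rewrite fE ge0_mule_fsumr//; over.
rewrite ge0_integral_fsum//; last 2 first.
- move=> r; apply: emeasurable_funM => //; apply: measurable_funeM.
  exact: measurable_kernel.
- by move=> r x _; exact: mule_ge0.
apply: eq_fsbigr => r _; rewrite nuE//.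
under [RHS]eq_integral do rewrite muleCA.
(* A negative [r] is not a value of [f]: its preimage is empty and both sides vanish. *)
have [r0|r0] := leP 0%R r.
  rewrite ge0_integralZl//.
  - by apply: emeasurable_funM => //; exact: measurable_kernel.
  - by move=> x _; rewrite mule_ge0.
rewrite [LHS](_ : _ = 0); last by rewrite -nuE// preimage_nnfun0// measure0 mule0.
by rewrite integral0_eq// => x _; rewrite preimage_nnfun0// measure0 !mule0.
Qed.

(** Extension from simple functions by monotone convergence. With [w = 1] it expresses the
    invariance of [mu] and the integral against a composed kernel; with [w = g] it handles the
    measure whose density gives the adjoint at [g]. *)
Lemma ge0_integral_mixture (h : F -> \bar R) :
  (forall y, 0 <= h y) -> measurable_fun setT h ->
  \int[nu]_y h y = \int[mu]_x ((w x)%:E * \int[k x]_y h y).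
Proof.
move=> h0 mh; pose f := nnsfun_approx measurableT mh.
have f0 n y : 0 <= (f n y)%:E by rewrite lee_fin.
have mf n : measurable_fun setT (fun y => (f n y)%:E) by exact/measurable_EFinP.
have ndf y : {homo (fun n => (f n y)%:E) : m n / (m <= n)%N >-> m <= n}.
  by move=> m n mn; rewrite lee_fin; exact/lefP/nd_nnsfun_approx.
have fh y : (fun n => (f n y)%:E) @ \oo --> h y by exact: cvg_nnsfun_approx.
have limE (m : {measure set F -> \bar R}) :
    (fun n => \int[m]_y (f n y)%:E) @ \oo --> \int[m]_y h y.
  exact: nd_ge0_cvg_integral.
have := limE nu; rewrite (_ : (fun n => _) =
    (fun n => \int[mu]_x ((w x)%:E * \int[k x]_y (f n y)%:E))); last first.
  by apply/funext => n; exact: integral_mixture_nnsfun.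
move=> /(cvg_unique (@ereal_hausdorff R)); apply.
have kf0 n x : 0 <= \int[k x]_y (f n y)%:E by exact: integral_ge0.
apply: nd_ge0_cvg_integral => //.
- move=> n; apply: emeasurable_funM => //.
  exact: ge0_measurable_kernel_integral.
- by move=> n x; exact: mule_ge0.
- move=> x m n mn; apply: lee_wpmul2l => //.
  by apply: ge0_le_integral => // y _; exact: ndf.
- by move=> x; apply: cvgeZl => //; exact: limE.
Qed.

End kernel_integral.

(** * Bounded measurable functions *)

Section bounded_measurable.
Context d (E : measurableType d) (R : realType).
Implicit Types (f g : E -> R).

(** The bound holds everywhere, not just almost everywhere, so that it serves under [mu] and under
    each [T x] alike. *)
Definition bounded_mfun f :=
  measurable_fun setT f /\ exists b : R, forall x, `|f x| <= b.

Lemma bounded_mfun_cst (c : R) : bounded_mfun (fun=> c).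
Proof. by split => //; exists `|c|. Qed.

Lemma bounded_mfunD f g :
  bounded_mfun f -> bounded_mfun g -> bounded_mfun (fun x => f x + g x).
Proof.
move=> [mf [b fb]] [mg [c gc]]; split; first exact: measurable_funD.
by exists (b + c) => x; rewrite (le_trans (ler_normD _ _))// lerD.
Qed.

Lemma bounded_mfunM f g :
  bounded_mfun f -> bounded_mfun g -> bounded_mfun (fun x => f x * g x).
Proof.
move=> [mf [b fb]] [mg [c gc]]; split; first exact: measurable_funM.
by exists (b * c) => x; rewrite normrM ler_pM.
Qed.

Lemma bounded_mfunB f g :
  bounded_mfun f -> bounded_mfun g -> bounded_mfun (fun x => f x - g x).
Proof.
move=> bf bg; have := bounded_mfunD bf (bounded_mfunM (bounded_mfun_cst (-1)) bg).
by under eq_fun do rewrite mulN1r.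
Qed.

Lemma bounded_mfunX f n : bounded_mfun f -> bounded_mfun (fun x => f x ^+ n).
Proof.
move=> bf; elim: n => [|n ih]; first exact: bounded_mfun_cst.
by under eq_fun do rewrite exprS; exact: bounded_mfunM.
Qed.

Variable P : {measure set E -> \bar R}.
Hypothesis PT : P setT = 1%E.

Lemma bounded_mfun_Lfun2 f : bounded_mfun f -> f \in Lfun P 2%:E.
Proof. by move=> [mf [b fb]]; exact: (bounded_Lfun2 PT mf fb). Qed.

Lemma bounded_mfun_integrable f : bounded_mfun f ->
  P.-integrable setT (EFin \o f).
Proof. by move=> bf; apply: Lfun2_integrable => //; exact: bounded_mfun_Lfun2. Qed.

Lemma norm_Rintegral_le f (b : R) : measurable_fun setT f ->
  (forall x, `|f x| <= b) -> `|\int[P]_x f x| <= b.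
Proof.
move=> mf fb; have bf : bounded_mfun f by split => //; exists b.
have nf : bounded_mfun (fun x => `|f x|).
  by split; [exact: measurableT_comp|exists b => x; rewrite normr_id].
apply: le_trans (le_normr_Rintegral measurableT (bounded_mfun_integrable bf)) _.
have <- : \int[P]_x b = b by rewrite Rintegral_cst// PT mulr1.
apply: le_Rintegral => //; apply: bounded_mfun_integrable => //.
exact: bounded_mfun_cst.
Qed.

End bounded_measurable.

(** * Action of an invariant Markov kernel on functions *)

Section markov_operator.
Context d (E : measurableType d) (R : realType).
Variables (mu : probability E R) (T : R.-pker E ~> E).
Hypothesis Tinv : kernel_invariant mu T.
Implicit Types f g : E -> R.

Let muT : mu setT = 1%E. Proof. exact: probability_setT. Qed.

Let TT x : T x setT = 1%E. Proof. exact: prob_kernel. Qed.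

Lemma ge0_integral_invariant (h : E -> \bar R) :
  (forall y, 0 <= h y)%E -> measurable_fun setT h ->
  (\int[mu]_x \int[T x]_y h y = \int[mu]_x h x)%E.
Proof.
move=> h0 mh; rewrite [RHS](@ge0_integral_mixture _ _ _ _ _ mu T (fun=> 1%R))//.
  by apply: eq_integral => x _; rewrite mul1e.
by move=> A mA; rewrite -[LHS]Tinv//; apply: eq_integral => x _; rewrite mul1e.
Qed.

(** For a [mu]-null set [N], the integral of [T x N] is [mu N = 0], so [T x N] vanishes for almost
    every [x]. *)
Lemma ae_invariant (Q : E -> Prop) : {ae mu, forall y, Q y} ->
  {ae mu, forall x, {ae T x, forall y, Q y}}.
Proof.
move=> [N [mN N0 QN]].
have : (\int[mu]_x `|T x N| = 0)%E.
  under eq_integral do rewrite gee0_abs//.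
  by rewrite Tinv.
move/(ae_eq_integral_abs mu measurableT (measurable_kernel T N mN)).
by apply: filterS => x /(_ I) TxN; exists N.
Qed.

Lemma kernel_op_ae_eq f g : measurable_fun setT f -> measurable_fun setT g ->
  {ae mu, forall x, f x = g x} ->
  {ae mu, forall x, kernel_op T f x = kernel_op T g x}.
Proof.
move=> mf mg /ae_invariant; apply: filterS => x fg.
congr fine; apply: ae_eq_integral => //; try exact/measurable_EFinP.
by apply: filterS fg => y -> _.
Qed.

Lemma measurable_kernel_op f : measurable_fun setT f ->
  measurable_fun setT (kernel_op T f).
Proof.
move=> mf; apply: measurableT_comp => //.
under eq_fun do rewrite integralE.
by apply: emeasurable_funB; apply: ge0_measurable_kernel_integral => //;
  [apply: measurable_funepos|apply: measurable_funeneg]; exact/measurable_EFinP.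
Qed.

Lemma norm_kernel_op_le f (b : R) : measurable_fun setT f ->
  (forall x, `|f x| <= b) -> forall x, `|kernel_op T f x| <= b.
Proof. by move=> mf fb x; exact: norm_Rintegral_le. Qed.

Lemma bounded_mfun_kernel_op f : bounded_mfun f -> bounded_mfun (kernel_op T f).
Proof.
move=> [mf [b fb]]; split; first exact: measurable_kernel_op.
by exists b; exact: norm_kernel_op_le.
Qed.

(** Jensen's inequality under each [T x], followed by invariance applied to the square of [f]. *)
Lemma kernel_op_Lfun2 f : f \in Lfun mu 2%:E ->
  kernel_op T f \in Lfun mu 2%:E.
Proof.
move=> /LfunP2[mf fi]; apply/LfunP2; split; first exact: measurable_kernel_op.
apply: le_lt_trans fi.
have mf2 : measurable_fun setT (fun x => (f x ^+ 2)%:E).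
  exact/measurable_EFinP/measurable_funX.
have f20 y : (0 <= (f y ^+ 2)%:E)%E by rewrite lee_fin sqr_ge0.
rewrite -[leRHS]ge0_integral_invariant//.
apply: ge0_le_integral => //.
- by move=> x _; rewrite lee_fin sqr_ge0.
- exact/measurable_EFinP/measurable_funX/measurable_kernel_op.
- exact: (ge0_measurable_kernel_integral T f20 mf2).
- by move=> x _; exact: sqr_integral_le.
Qed.

(** Adding the bound [b] makes [f] non-negative, where invariance is available; the constant then
    cancels. *)
Lemma integral_kernel_op f : bounded_mfun f ->
  \int[mu]_x kernel_op T f x = \int[mu]_x f x.
Proof.
move=> bf; have [mf [b fb]] := bf.
have bKf := bounded_mfun_kernel_op bf.
have bb := bounded_mfun_cst E b.
have fb0 y : 0 <= f y + b.
  by have := fb y; rewrite ler_norml => /andP[]; lra.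
have KE x : (\int[T x]_y (f y + b)%:E = (kernel_op T f x + b)%:E)%E.
  rewrite -[LHS]fineK; last first.
    apply: integrable_fin_num => //; apply: (bounded_mfun_integrable (TT x)).
    exact: bounded_mfunD.
  congr EFin; rewrite [LHS](_ : _ = \int[T x]_y (f y + b))//.
  rewrite RintegralD ?Rintegral_cst ?TT ?mulr1//;
    exact: bounded_mfun_integrable.
have : \int[mu]_x (kernel_op T f x + b) = \int[mu]_x (f x + b).
  congr fine; rewrite -[RHS]ge0_integral_invariant//.
  - by apply: eq_integral => x _; rewrite KE.
  - by apply/measurable_EFinP/measurable_funD.
by rewrite !RintegralD//; [move/addIr|exact: bounded_mfun_integrable..].
Qed.

End markov_operator.

(** * Jump energy *)

Section jump_energy.
Context d (E : measurableType d) (R : realType).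
Variable mu : probability E R.
Implicit Types (k : R.-spker E ~> E) (f : E -> R).

(** Sub-probability kernels are allowed because [kernel_pow T n] is typed as one. *)
Definition jump_energy k f : \bar R :=
  (\int[mu]_x \int[k x]_y ((f x - f y) ^+ 2)%:E)%E.

Let sqr0 (r : R) : (0 <= (r ^+ 2)%:E)%E. Proof. by rewrite lee_fin sqr_ge0. Qed.

Lemma jump_energy_ge0 k f : (0 <= jump_energy k f)%E.
Proof. by apply: integral_ge0 => x _; apply: integral_ge0. Qed.

Lemma measurable_sqr_diff f : measurable_fun setT f ->
  measurable_fun setT (fun p : E * E => ((f p.1 - f p.2) ^+ 2)%:E).
Proof.
move=> mf; apply/measurable_EFinP/measurable_funX/measurable_funB.
- exact: measurableT_comp measurable_fst.
- exact: measurableT_comp measurable_snd.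
Qed.

Lemma measurable_sqr_diffr f x : measurable_fun setT f ->
  measurable_fun setT (fun y => ((f x - f y) ^+ 2)%:E).
Proof. by move=> mf; apply/measurable_EFinP/measurable_funX/measurable_funB. Qed.

Lemma measurable_inner_energy k f : measurable_fun setT f ->
  measurable_fun setT (fun x => \int[k x]_y ((f x - f y) ^+ 2)%:E)%E.
Proof.
move=> mf; apply: (measurable_fun_integral_sfinite_kernel
  (fun p : E * E => ((f p.1 - f p.2) ^+ 2)%:E) k) => //.
exact: measurable_sqr_diff.
Qed.

Variable T : R.-pker E ~> E.
Hypothesis Tinv : kernel_invariant mu T.

(** Along a path x, y, z, [(a - c)^2 <= 2 (a - b)^2 + 2 (b - c)^2]. The first jump is integrated
    against [k y], of mass at most one; the second starts from a [T]-step of [mu], which is [mu]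
    again. *)
Lemma jump_energy_kcomp_le k f : measurable_fun setT f ->
  (jump_energy (mkcomp_noparam T k) f <=
   2%:E * jump_energy T f + 2%:E * jump_energy k f)%E.
Proof.
move=> mf; pose h y := (\int[k y]_z ((f y - f z) ^+ 2)%:E)%E.
have h0 y : (0 <= h y)%E by exact: integral_ge0.
have mh : measurable_fun setT h by exact: measurable_inner_energy.
have mTh : measurable_fun setT (fun x => \int[T x]_y h y)%E.
  exact: ge0_measurable_kernel_integral.
have mT := measurable_inner_energy T mf.
have mc (c : \bar R) (g : E -> \bar R) : measurable_fun setT g ->
  measurable_fun setT (fun x => c * g x)%E by exact: measurable_funeM.
have mfx x := measurable_sqr_diffr x mf.
(* Invariance is used backwards to insert a [T]-step before [k], so that both sides can be compared
   pointwise in [x], then in [y]. *)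
have TE : (2%:E * jump_energy T f + 2%:E * jump_energy k f =
    \int[mu]_x (2%:E * (\int[T x]_y ((f x - f y) ^+ 2)%:E) +
                2%:E * \int[T x]_y h y))%E.
  rewrite ge0_integralD//; try by move=> x _; rewrite mule_ge0 ?integral_ge0.
  - rewrite !ge0_integralZl//; try by move=> x _; exact: integral_ge0.
    by rewrite ge0_integral_invariant.
  - exact: mc.
  - exact: mc.
rewrite TE; apply: ge0_le_integral => //.
- by move=> x _; exact: integral_ge0.
- exact: measurable_inner_energy.
- by apply: emeasurable_funD; exact: mc.
move=> x _.
rewrite (@ge0_integral_mixture _ _ _ _ _ (T x) k (fun=> 1%R))//; last first.
  by move=> A mA; apply: eq_integral => y _; rewrite mul1e.
rewrite -!ge0_integralZl// -ge0_integralD//; try by move=> y _; exact: mule_ge0.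
2,3: exact: mc.
apply: ge0_le_integral => //.
- by move=> y _; rewrite mul1e; exact: integral_ge0.
- by under eq_fun do rewrite mul1e; exact: ge0_measurable_kernel_integral.
- by apply: emeasurable_funD; exact: mc.
move=> y _; rewrite mul1e.
apply: (@le_trans _ _ (\int[k y]_z (2%:E * ((f x - f y) ^+ 2)%:E +
    2%:E * ((f y - f z) ^+ 2)%:E))%E).
  apply: ge0_le_integral => //.
  - by apply: emeasurable_funD => //; exact: mc.
  - move=> z _; rewrite -!EFinM -EFinD lee_fin.
    have := sqr_ge0 ((f x - f y) - (f y - f z)); nra.
rewrite ge0_integralD//; last 3 first.
- by move=> z _; rewrite mule_ge0.
- by move=> z _; rewrite mule_ge0.
- exact: mc.
rewrite integral_cst// ge0_integralZl// leeD2r// -[leRHS]mule1.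
by rewrite lee_wpmul2l ?sprob_kernel_le1// lee_fin mulr_ge0 ?sqr_ge0.
Qed.

(** The Dirac kernel has no jumps, and each composition turns [c] into [2 + 2 * c]. The growth in
    [n] is harmless, since each power is treated separately. *)
Lemma jump_energy_pow_le n : exists2 c : R, 0 <= c &
  forall f, measurable_fun setT f ->
    (jump_energy (kernel_pow T n) f <= c%:E * jump_energy T f)%E.
Proof.
elim: n => [|n [c c0 ih]].
  exists 0 => // f mf; rewrite mul0e /jump_energy integral0_eq// => x _.
  rewrite /= /kdirac integral_dirac//; last exact: measurable_sqr_diffr.
  by rewrite subrr expr0n /= mule0.
exists (2 + 2 * c) => [|f mf]; first by rewrite addr_ge0 ?mulr_ge0.
apply: le_trans (jump_energy_kcomp_le _ mf) _.
rewrite (_ : (2 + 2 * c)%:E = (2%:E + 2%:E * c%:E)%E)//.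
rewrite ge0_muleDl ?mule_ge0 ?lee_fin// leeD2l// -muleA.
by rewrite lee_wpmul2l// ih.
Qed.

Let muT : mu setT = 1%E. Proof. exact: probability_setT. Qed.

Let TT x : T x setT = 1%E. Proof. exact: prob_kernel. Qed.

Lemma inner_energyE f x : bounded_mfun f ->
  (\int[T x]_y ((f x - f y) ^+ 2)%:E =
   (f x ^+ 2 - 2 * (f x * kernel_op T f x) +
    kernel_op T (fun y => f y ^+ 2) x)%:E)%E.
Proof.
by move=> bf; rewrite integral_sqrB//; [rewrite mulrA|exact: bounded_mfun_Lfun2].
Qed.

(** After expanding the square, invariance turns the mean of [T (f^2)] into that of [f^2], leaving
    twice [||f||^2 - <f, T f>]. *)
Lemma jump_energyE f : bounded_mfun f ->
  jump_energy T f = (2 * dirichlet mu (kernel_op T) f)%:E.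
Proof.
move=> bf; have bKf := bounded_mfun_kernel_op T bf.
have bf2 := bounded_mfunX 2 bf.
have bfK := bounded_mfunM bf bKf.
have b2fK := bounded_mfunM (bounded_mfun_cst E (2 : R)) bfK.
have bK2 := bounded_mfun_kernel_op T bf2.
have ib := bounded_mfun_integrable muT.
have -> : dirichlet mu (kernel_op T) f =
    \int[mu]_x (f x ^+ 2) - \int[mu]_x (f x * kernel_op T f x).
  rewrite -RintegralB//; [|exact: ib..].
  by apply: eq_Rintegral => x _ /=; ring.
rewrite /jump_energy; under eq_integral do rewrite inner_energyE//.
rewrite -[LHS]fineK; last first.
  apply: integrable_fin_num => //; apply: ib.
  by apply: bounded_mfunD => //; exact: bounded_mfunB.
rewrite -/(Rintegral _ _ _) RintegralD//; last 2 first.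
- by apply: ib; exact: bounded_mfunB.
- exact: ib.
rewrite RintegralB//; [|exact: ib..].
rewrite RintegralZl//; last exact: ib.
rewrite integral_kernel_op//; congr EFin; ring.
Qed.

Lemma dirichlet_kernel_op_ge0 f : bounded_mfun f ->
  0 <= dirichlet mu (kernel_op T) f.
Proof.
move=> bf; have := jump_energy_ge0 T f; rewrite jump_energyE// lee_fin.
by rewrite pmulr_rge0.
Qed.

End jump_energy.

(** * Weak Poincare inequality for bounded functions *)

Lemma nneseries_lty_cvg0 (R : realType) (u : (\bar R)^nat) :
  (forall n, 0 <= u n)%E -> (\sum_(0 <= n <oo) u n < +oo)%E -> u @ \oo --> 0%E.
Proof.
move=> u0 uoo; have tail := nneseries_tail_cvg uoo (fun k _ => u0 k).
apply: (@squeeze_cvge _ _ _ _ (fun=> 0%E) _ _ _ _ _ tail); last exact: cvg_cst.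
apply: nearW => n; rewrite u0/= (nneseries_split _ 1)//.
by rewrite addn1 big_nat1 leeDl// nneseries_ge0.
Qed.

Lemma ae_nneseries_lty d (T : measurableType d) (R : realType)
    (m : {measure set T -> \bar R}) (g : (T -> \bar R)^nat) :
  (forall n, measurable_fun setT (g n)) -> (forall n x, 0 <= g n x)%E ->
  (\sum_(0 <= n <oo) \int[m]_x g n x < +oo)%E ->
  {ae m, forall x, (\sum_(0 <= n <oo) g n x < +oo)%E}.
Proof.
move=> mg g0 goo; pose G x := (\sum_(0 <= n <oo) g n x)%E.
have G0 x : (0 <= G x)%E by exact: nneseries_ge0.
have iG : m.-integrable setT G.
  apply/integrableP; split; first exact: ge0_emeasurable_sum.
  by under eq_integral do rewrite gee0_abs//; rewrite integral_nneseries.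
apply: filterS (integrable_ae measurableT iG) => x /(_ I).
by rewrite ge0_fin_numE.
Qed.

Section weak_poincare.
Context d (E : measurableType d) (R : realType).
Variables (mu : probability E R) (T : R.-pker E ~> E).
Hypothesis Tinv : kernel_invariant mu T.
Hypothesis Tirr : kernel_irreducible mu T.

Let muT : mu setT = 1%E. Proof. exact: probability_setT. Qed.

Let sqr0 (r : R) : (0 <= (r ^+ 2)%:E)%E. Proof. by rewrite lee_fin sqr_ge0. Qed.

(** Absolute continuity of [mu] with respect to the resolvent started at the single point [x]. *)
Lemma irreducible_null (x : E) (B : set E) : measurable B ->
  (forall n, kernel_pow T n x B = 0%E) -> mu B = 0%E.
Proof.
move=> mB B0; apply/eqP; apply: contrapT => /negP muB.
have {muB} : (0 < mu B)%E by rewrite lt0e muB measure_ge0.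
move=> /(Tirr mB)[l _ /(_ x)]; rewrite eseries0 ?ltxx// => n _ _.
by rewrite B0 mule0.
Qed.

Lemma jump_energy_summable (f : (E -> R)^nat) :
  (forall k, measurable_fun setT (f k)) ->
  (\sum_(0 <= k <oo) jump_energy mu T (f k) < +oo)%E ->
  exists x, {ae mu, forall y,
    (\sum_(0 <= k <oo) ((f k x - f k y) ^+ 2)%:E < +oo)%E}.
Proof.
move=> mf foo.
(* Countably many null sets are merged, so that one [x] serves all powers [n]. *)
have : \forall x \ae mu, forall n,
  (\sum_(0 <= k <oo) \int[kernel_pow T n x]_y ((f k x - f k y) ^+ 2)%:E < +oo)%E.
  apply: ae_foralln => n; apply: ae_nneseries_lty.
  - by move=> k; exact: measurable_inner_energy.
  - by move=> k x; exact: integral_ge0.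
  - have [c c0 cE] := jump_energy_pow_le Tinv n.
    apply: (@le_lt_trans _ _ (\sum_(0 <= k <oo) (c%:E * jump_energy mu T (f k)))%E).
      by apply: lee_nneseries => k _ *; [exact: jump_energy_ge0|exact: cE].
    rewrite nneseriesZl; last by move=> *; exact: jump_energy_ge0.
    by rewrite lte_mul_pinfty// lee_fin.
have muF : ProperFilter (almost_everywhere mu).
  have muT0 : (0 < mu setT)%E by rewrite muT.
  exact: ae_properfilter_algebraOfSetsType muT0.
move=> /filter_ex[x xoo]; exists x.
pose G y := (\sum_(0 <= k <oo) ((f k x - f k y) ^+ 2)%:E)%E.
have mfx k := measurable_sqr_diffr x (mf k).
have mG : measurable_fun setT G by exact: ge0_emeasurable_sum.
(* The divergence set is null under every [T^n(x, .)], hence under [mu]. *)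
pose B := G @^-1` [set +oo%E].
have mB : measurable B by rewrite -[B]setTI; exact: mG.
have muB : mu B = 0%E.
  apply: (@irreducible_null x) => // n; apply: measure_negligible => //.
  have := ae_nneseries_lty mfx (fun k y => sqr0 _) (xoo n).
  by apply: negligibleS => y; rewrite /B /= => Gy; rewrite -/(G y) Gy ltxx.
exists B; split => // y /=.
by move/negP; rewrite -leNgt leye_eq => /eqP.
Qed.

Lemma jump_energy_not_summable (f : (E -> R)^nat) (r : R) : 0 < r ->
  (forall k, measurable_fun setT (f k)) -> (forall k x, `|f k x| <= 1) ->
  (forall k, \int[mu]_x f k x = 0) ->
  (forall k, r <= \int[mu]_x (f k x ^+ 2)) ->
  (\sum_(0 <= k <oo) jump_energy mu T (f k) = +oo)%E.
Proof.
move=> r0 mf f1 f0 fr; apply/eqP; rewrite -leye_eq leNgt; apply/negP.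
move=> /(jump_energy_summable mf)[x xoo].
have mfx k := measurable_sqr_diffr x (mf k).
(* The terms of a convergent series tend to 0, and 4 dominates them because [|f k| <= 1]. *)
have [||||_ _ /=] := @dominated_convergence _ _ _ mu setT measurableT
    (fun k y => ((f k x - f k y) ^+ 2)%:E) (cst 0%E) (cst 4%:E) mfx.
- exact: measurable_cst.
- by apply: filterS xoo => y yoo _; exact: nneseries_lty_cvg0.
- exact: finite_measure_integrable_cst.
- apply: aeW => y k _; rewrite gee0_abs//= lee_fin.
  have := f1 k x; have := f1 k y; rewrite !ler_norml => /andP[? ?] /andP[? ?].
  nra.
rewrite integral0 => lim0.
suff : (r%:E <= 0)%E by rewrite lee_fin leNgt r0.
apply: (cvge_to_ge lim0); apply: nearW => k /=.
have bf : bounded_mfun (f k) by split => //; exists 1.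
(* The mean of [f k] is zero, so the cross term drops and the integral is at least the second moment
   of [f k]. *)
rewrite integral_sqrB//; last exact: bounded_mfun_Lfun2.
by rewrite f0 mulr0 subr0 lee_fin (le_trans (fr k))// lerDr sqr_ge0.
Qed.

Lemma weak_poincare_unit (r : R) : 0 < r ->
  exists2 C : R, 0 <= C & forall f : E -> R, measurable_fun setT f ->
    (forall x, `|f x| <= 1) -> \int[mu]_x f x = 0 ->
    \int[mu]_x (f x ^+ 2) <= C * dirichlet mu (kernel_op T) f + r.
Proof.
move=> r0; apply: contrapT => noC.
(* Since second moments are at most 1, violating the inequality with constant [2 ^ k.+1] forces a
   Dirichlet form at most [2 ^- k.+1]; the jump energies, twice as large, then sum to at most 2. *)
have : forall k : nat, exists f : E -> R, [/\ measurable_fun setT f,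
    (forall x, `|f x| <= 1), \int[mu]_x f x = 0 &
    (2 ^ k.+1)%:R * dirichlet mu (kernel_op T) f + r < \int[mu]_x (f x ^+ 2)].
  move=> k; apply: contrapT => nof; apply: noC; exists (2 ^ k.+1)%:R => //.
  move=> f mf f1 f0; rewrite leNgt; apply/negP => flt.
  by apply: nof; exists f.
move=> /choice[f /all_and4[mf f1 f0 fr]].
have bf k : bounded_mfun (f k) by split => //; exists 1.
have D0 k : 0 <= dirichlet mu (kernel_op T) (f k) by exact: dirichlet_kernel_op_ge0.
have sf1 k : \int[mu]_x (f k x ^+ 2) <= 1.
  apply: (le_trans (ler_norm _)); apply: norm_Rintegral_le => //.
    exact: measurable_funX.
  by move=> x; rewrite normrX exprn_ile1.
have : (\sum_(0 <= k <oo) jump_energy mu T (f k) <= 2%:E)%E.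
  apply: le_trans (epsilon_trick0 xpredT (ltW (ltr0n R 2))).
  apply: lee_nneseries => k _; first by move=> *; exact: jump_energy_ge0.
  rewrite jump_energyE// lee_fin ler_wpM2l// -[leRHS]mul1r ler_pdivlMr ?ltr0n ?expn_gt0//.
  by rewrite mulrC (le_trans _ (sf1 k))// (le_trans _ (ltW (fr k)))// lerDl ltW.
rewrite (jump_energy_not_summable r0)// => k; rewrite (le_trans _ (ltW (fr k)))//.
by rewrite lerDr mulr_ge0.
Qed.

End weak_poincare.

(** * Monotone rates from separately chosen constants *)

Section rates.
Context (R : realType).

(** A larger [r] admits more constants, so the infimum of the admissible ones is non-increasing in
    [r]. *)
Lemma exists_nonincreasing_rate (Q : R -> R -> Prop) :
  (forall r, 0 < r -> exists2 C, 0 <= C & Q r C) ->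
  (forall r s C, r <= s -> Q r C -> Q s C) ->
  (forall r C D, C <= D -> Q r C -> Q r D) ->
  exists alpha : R -> R,
    [/\ forall r, 0 < r -> 0 <= alpha r,
        forall r s, 0 < r -> r <= s -> alpha s <= alpha r &
        forall r, 0 < r -> Q r (alpha r)].
Proof.
move=> exQ Qr QC; pose V r := [set C | 0 <= C /\ Q r C].
have V0 r : lbound (V r) 0 by move=> C [].
have hV r : 0 < r -> has_inf (V r).
  by move=> /exQ[C C0 QrC]; split; [exists C|exists 0].
(* The added [1] dispenses with showing that the infimum is attained. *)
exists (fun r => inf (V r) + 1); split => [r r0|r s r0 rs|r r0].
- rewrite addr_ge0//; apply: lb_le_inf => //; exact: (hV r r0).1.
- rewrite lerD2r; apply: lb_le_inf; first exact: (hV r r0).1.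
  move=> C [C0 QrC]; apply: ge_inf; first by exists 0.
  by split => //; exact: Qr QrC.
- have [C [C0 QrC] Clt] := inf_adherent ltr01 (hV r r0).
  exact: QC (ltW Clt) QrC.
Qed.

Lemma exists_vanishing_rate (Q : nat -> R -> Prop) :
  (exists2 C, 0 <= C & Q 0 C) ->
  (forall m n C, (m <= n)%N -> Q m C -> Q n C) ->
  (forall n C D, C <= D -> Q n C -> Q n D) ->
  (forall e, 0 < e -> exists n, Q n e) ->
  exists gamma : nat -> R,
    [/\ forall n, 0 < gamma n,
        forall m n, (m <= n)%N -> gamma n <= gamma m,
        gamma n @[n --> \oo] --> 0 &
        forall n, Q n (gamma n)].
Proof.
move=> [C0 C00 Q0] Qn QC Qe; pose V n := [set C | 0 <= C /\ Q n C].
have V0 n : lbound (V n) 0 by move=> C [].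
have hV n : has_inf (V n).
  by split; [exists C0; split => //; exact: Qn Q0|exists 0].
have Vge0 n : 0 <= inf (V n) by apply: lb_le_inf => //; exact: (hV n).1.
have Vle m n : (m <= n)%N -> inf (V n) <= inf (V m).
  move=> mn; apply: lb_le_inf; first exact: (hV m).1.
  move=> C [C0' QmC]; apply: ge_inf; first by exists 0.
  by split => //; exact: Qn QmC.
have inv0 : @harmonic R @ \oo --> 0 by exact: cvg_harmonic.
have V_to0 : inf (V n) @[n --> \oo] --> 0.
  apply/cvgrPdist_le => e e0; have [N QNe] := Qe e e0.
  exists N => // n /= Nn; rewrite sub0r normrN ger0_norm//.
  apply: le_trans (Vle _ _ Nn) _; apply: ge_inf; first by exists 0.
  by split => //; exact: ltW.
(* The harmonic term puts the rate strictly above the infimum, hence among the admissible constants,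
   without spoiling monotonicity or the limit. It also makes the rate positive, which matters for
   infinite oscillation as [0 * +oo = 0]. *)
exists (fun n => inf (V n) + harmonic n); split.
- by move=> n; rewrite ltr_wpDl// harmonic_gt0.
- move=> m n mn; rewrite lerD ?Vle//= lef_pV2 ?posrE ?ltr0n//.
  by rewrite ler_nat ltnS.
- by rewrite -[0]addr0; exact: cvgD.
- move=> n; have [C [_ QnC] Clt] := inf_adherent (harmonic_gt0 n) (hV n).
  exact: QC (ltW Clt) QnC.
Qed.

End rates.

(** * Scaling, energy drop and geometric decay for bounded functions *)

Section bounded_inequalities.
Context d (E : measurableType d) (R : realType).
Variables (mu : probability E R) (T : R.-pker E ~> E).
Hypothesis Tinv : kernel_invariant mu T.

Local Notation K := (kernel_op T).

Let muT : mu setT = 1%E. Proof. exact: probability_setT. Qed.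

Let TT x : T x setT = 1%E. Proof. exact: prob_kernel. Qed.

Lemma kernel_opZ (f : E -> R) (c : R) : bounded_mfun f ->
  K (fun x => c * f x) = (fun x => c * K f x).
Proof.
move=> bf; apply/funext => x; rewrite /kernel_op RintegralZl//.
exact: bounded_mfun_integrable.
Qed.

Lemma dirichlet_kernel_opZ f (c : R) : bounded_mfun f ->
  dirichlet mu K (fun x => c * f x) = c ^+ 2 * dirichlet mu K f.
Proof.
move=> bf; have bKf := bounded_mfun_kernel_op T bf.
rewrite /dirichlet /inner2 kernel_opZ// -RintegralZl//.
  by apply: eq_Rintegral => x _ /=; ring.
apply: (bounded_mfun_integrable muT).
by apply: bounded_mfunM => //; exact: bounded_mfunB.
Qed.

(** Both sides are homogeneous of degree two, so the unit case is applied to [f / b]; if [b = 0]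
    then [f] vanishes. *)
Lemma weak_poincare_bounded (r : R) : kernel_irreducible mu T -> 0 < r ->
  exists2 C : R, 0 <= C & forall (f : E -> R) (b : R), measurable_fun setT f ->
    (forall x, `|f x| <= b) -> \int[mu]_x f x = 0 -> 0 <= b ->
    \int[mu]_x (f x ^+ 2) <= C * dirichlet mu K f + r * b ^+ 2.
Proof.
move=> Tirr r0; have [C C0 CE] := weak_poincare_unit Tinv Tirr r0.
exists C => // f b mf fb f0; rewrite le_eqVlt => /predU1P[b0|b0].
  have f00 x : f x = 0 by apply/eqP; rewrite -normr_le0 b0.
  rewrite -b0 expr0n/= mulr0 addr0.
  have -> : \int[mu]_x (f x ^+ 2) = \int[mu]_x 0.
    by apply: eq_Rintegral => x _; rewrite f00 expr0n.
  rewrite Rintegral_cst// mul0r mulr_ge0// dirichlet_kernel_op_ge0//.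
  by split => //; exists b.
have bf : bounded_mfun f by split => //; exists b.
have H : b^-1 ^+ 2 * \int[mu]_x (f x ^+ 2) <=
    C * (b^-1 ^+ 2 * dirichlet mu K f) + r.
  rewrite -dirichlet_kernel_opZ// -RintegralZl//; last first.
    by apply: bounded_mfun_integrable => //; exact: bounded_mfunX.
  under eq_Rintegral do rewrite -exprMn.
  apply: CE; first exact: measurable_funM.
    move=> x; rewrite normrM [`|b^-1|]gtr0_norm ?invr_gt0//.
    by rewrite mulrC ler_pdivrMr// mul1r.
  by rewrite RintegralZl ?f0 ?mulr0//; exact: bounded_mfun_integrable.
have b20 : 0 < b ^+ 2 by rewrite exprn_gt0.
have bN0 : b != 0 by rewrite gt_eqF.
move: H; rewrite -(ler_pM2l b20).
set S := \int[mu]_x _; set D := dirichlet _ _ _.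
have -> : b ^+ 2 * (b^-1 ^+ 2 * S) = S by field.
by have -> : b ^+ 2 * (C * (b^-1 ^+ 2 * D) + r) = C * D + r * b ^+ 2 by field.
Qed.

(* Writing [m = T f x], the variance [v = T (f^2) x - m^2] of [f] under [T x]
   is at least [(m - f x)^2 T x {x}] because of the atom at [x], while the
   inner energy at [x] is [v + (m - f x)^2]. *)
Lemma energy_drop (c : R) (f : E -> R) : 0 < c ->
  (forall x : E, measurable [set x]) ->
  {ae mu, forall x, (c%:E <= T x [set x])%E} -> bounded_mfun f ->
  2 * dirichlet mu K f <=
    (1 + c^-1) * (\int[mu]_x (f x ^+ 2) - \int[mu]_x (K f x ^+ 2)).
Proof.
move=> c0 m1 cT bf; have bKf := bounded_mfun_kernel_op T bf.
have bf2 := bounded_mfunX 2 bf; have bKf2 := bounded_mfunX 2 bKf.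
have bK2 := bounded_mfun_kernel_op T bf2.
have bv := bounded_mfunB bK2 bKf2.
have ib := bounded_mfun_integrable muT.
pose v x := K (fun y => f y ^+ 2) x - K f x ^+ 2.
have vE x : (v x)%:E = (\int[T x]_y ((K f x - f y) ^+ 2)%:E)%E.
  rewrite integral_sqrB//; last exact: bounded_mfun_Lfun2.
  by congr EFin; rewrite /v /kernel_op; ring.
have cv x : (c%:E <= T x [set x])%E -> c * (K f x - f x) ^+ 2 <= v x.
  move=> cTx; rewrite -lee_fin vE.
  apply: (@le_trans _ _ (\int[T x]_(y in [set x]) ((K f x - f y) ^+ 2)%:E)%E).
    rewrite (eq_integral (fun=> ((K f x - f x) ^+ 2)%:E)); last first.
      by move=> y; rewrite inE => ->.
    by rewrite integral_cst// EFinM muleC lee_wpmul2l// lee_fin sqr_ge0.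
  apply: ge0_subset_integral => //.
  - by apply/measurable_EFinP/measurable_funX/measurable_funB => //; case: bf.
  - by move=> y _; rewrite lee_fin sqr_ge0.
have <- : \int[mu]_x ((1 + c^-1) * v x) = (1 + c^-1) *
    (\int[mu]_x (f x ^+ 2) - \int[mu]_x (K f x ^+ 2)).
  rewrite RintegralZl//; last exact: ib.
  by rewrite RintegralB//; [rewrite integral_kernel_op|exact: ib..].
have bcv := bounded_mfunM (bounded_mfun_cst E (1 + c^-1)) bv.
rewrite -lee_fin -jump_energyE// [leRHS]fineK; last first.
  by apply: integrable_fin_num => //; exact: ib.
have v0 x : 0 <= v x.
  by rewrite -lee_fin vE; apply: integral_ge0 => y _; rewrite lee_fin sqr_ge0.
apply: ae_ge0_le_integral => //.
- by move=> x _; apply: integral_ge0 => y _; rewrite lee_fin sqr_ge0.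
- by apply: measurable_inner_energy; case: bf.
- by move=> x _; rewrite lee_fin mulr_ge0// addr_ge0// invr_ge0 ltW.
- by apply/measurable_EFinP; case: bcv.
apply: filterS cT => x /cv cvx _; rewrite inner_energyE// lee_fin.
have : (K f x - f x) ^+ 2 <= c^-1 * v x by rewrite mulrC ler_pdivlMr// mulrC.
rewrite mulrDl mul1r /v; lra.
Qed.

Lemma sqr_kernel_op_le f : bounded_mfun f ->
  \int[mu]_x (K f x ^+ 2) <= \int[mu]_x (f x ^+ 2).
Proof.
move=> bf; have bKf := bounded_mfun_kernel_op T bf.
have bf2 := bounded_mfunX 2 bf.
rewrite -[leRHS](integral_kernel_op Tinv)//.
apply: le_Rintegral => //; try apply: (bounded_mfun_integrable muT).
- exact: bounded_mfunX.
- exact: bounded_mfun_kernel_op.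
- by move=> x _; apply: sqr_Rintegral_le => //; exact: bounded_mfun_Lfun2.
Qed.

Lemma Rintegral_sqr_le (f : E -> R) (b : R) : measurable_fun setT f ->
  (forall x, `|f x| <= b) -> 0 <= b -> \int[mu]_x (f x ^+ 2) <= b ^+ 2.
Proof.
move=> mf fb b0; apply: (le_trans (ler_norm _)).
apply: norm_Rintegral_le => //; first exact: measurable_funX.
by move=> x; rewrite normrX lerXn2r ?nnegrE.
Qed.

Lemma iter_kernel_op (f : E -> R) (b : R) n : measurable_fun setT f ->
  (forall x, `|f x| <= b) -> \int[mu]_x f x = 0 ->
  [/\ measurable_fun setT (iter n K f), forall x, `|iter n K f x| <= b &
      \int[mu]_x iter n K f x = 0].
Proof.
move=> mf fb f0; elim: n => [//|n [mn nb n0]]; split => /=.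
- exact: measurable_kernel_op.
- exact: norm_kernel_op_le.
- by rewrite integral_kernel_op//; split => //; exists b.
Qed.

(** With [a_n] the second moment of [T^n f] and [q = 1 - 1/C], the hypothesis reads
    [a_(n+1) <= q a_n + (r/C) b^2]. This affine map fixes [r b^2], so the bound [(q^n + r) b^2]
    propagates; [C >= 1] ensures [q >= 0]. *)
Lemma geometric_decay (r C : R) : 1 <= C ->
  (forall (f : E -> R) (b : R), measurable_fun setT f ->
    (forall x, `|f x| <= b) -> \int[mu]_x f x = 0 -> 0 <= b ->
    \int[mu]_x (f x ^+ 2) <=
      C * (\int[mu]_x (f x ^+ 2) - \int[mu]_x (K f x ^+ 2)) + r * b ^+ 2) ->
  forall n (f : E -> R) (b : R), 0 <= r -> measurable_fun setT f ->
    (forall x, `|f x| <= b) -> \int[mu]_x f x = 0 -> 0 <= b ->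
    \int[mu]_x (iter n K f x ^+ 2) <= ((1 - C^-1) ^+ n + r) * b ^+ 2.
Proof.
move=> C1 CE n f b r0 mf fb f0 b0.
have C0 : 0 < C by exact: lt_le_trans C1.
elim: n => [|n ih].
  rewrite expr0 (le_trans (Rintegral_sqr_le mf fb b0))//.
  by rewrite ler_peMl ?sqr_ge0// lerDl.
have [mn nb n0] := iter_kernel_op n mf fb f0.
have := CE _ _ mn nb n0 b0; set a := \int[mu]_x _ in ih *.
rewrite iterS; set a' := \int[mu]_x _.
move=> h.
have {}h : C^-1 * (a - r * b ^+ 2) <= a - a'.
  by rewrite mulrC ler_pdivrMr// [leRHS]mulrC lerBlDr.
have q0 : 0 <= 1 - C^-1 by rewrite subr_ge0 invf_le1.
have := ler_wpM2l q0 ih; rewrite [_ ^+ n.+1]exprS; move: h.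
by move: (C^-1) ((1 - C^-1) ^+ n) (b ^+ 2) => ci p b2; lra.
Qed.

End bounded_inequalities.

(** * Oscillation and bounded representatives *)

Section oscillation.
Context d (E : measurableType d) (R : realType).
Variable mu : probability E R.
Implicit Types f g : E -> R.

Let muT : mu setT = 1%E. Proof. exact: probability_setT. Qed.

Lemma ae_eq_Rintegral f g : measurable_fun setT f -> measurable_fun setT g ->
  {ae mu, forall x, f x = g x} -> \int[mu]_x f x = \int[mu]_x g x.
Proof.
move=> mf mg fg; congr fine; apply: ae_eq_integral => //; try exact/measurable_EFinP.
by apply: filterS fg => x -> _.
Qed.

(** If [f <= t < 0] almost everywhere, then [|t - f|] has the same integral as [t - f], namely [t],
    which is negative. *)
Lemma ess_sup_ge0 f : mu.-integrable setT (EFin \o f) ->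
  \int[mu]_x f x = 0 -> (0 <= ess_sup mu (EFin \o f))%E.
Proof.
move=> fi f0; have mf : measurable_fun setT f by exact/measurable_EFinP/(measurable_int mu).
rewrite leNgt; apply/negP => s0.
have [t t0 st] : exists2 t : R, t < 0 & (ess_sup mu (EFin \o f) <= t%:E)%E.
  move: s0; case: (ess_sup _ _) => [s| |] //; first by rewrite lte_fin; exists s.
  by exists (-1) => //; rewrite leNye.
have it : mu.-integrable setT (EFin \o (fun=> t)).
  exact: finite_measure_integrable_cst.
have : \int[mu]_x (t - f x) = \int[mu]_x `|t - f x|.
  have mtf : measurable_fun setT (fun x => t - f x) by exact: measurable_funB.
  apply: ae_eq_Rintegral => //; first exact: measurableT_comp.
  move/ess_supP: st; apply: filterS => x /=; rewrite lee_fin => ftx.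
  by rewrite ger0_norm// subr_ge0.
rewrite RintegralB// f0 subr0 Rintegral_cst//= probability_setT mulr1 => tE.
by move: t0; rewrite tE ltNge Rintegral_ge0.
Qed.

Lemma ess_inf_le0 f : mu.-integrable setT (EFin \o f) ->
  \int[mu]_x f x = 0 -> (ess_inf mu (EFin \o f) <= 0)%E.
Proof.
move=> fi f0; rewrite ess_infEN oppe_le0.
apply: (@ess_sup_ge0 (fun x => - f x)).
  exact: (integrableN fi).
under eq_Rintegral do rewrite -mulN1r.
by rewrite RintegralZl// f0 mulr0.
Qed.

(** Mean zero puts 0 between the essential infimum and supremum, so [|f| <= osc f] almost
    everywhere, and truncating at that level alters [f] only on a null set. *)
Lemma L20_bounded_representative f : L20 mu f -> (osc mu f < +oo)%E ->
  exists (b : R) (g : E -> R), 0 <= b /\ osc mu f = b%:E /\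
    [/\ measurable_fun setT g, forall x, `|g x| <= b,
        {ae mu, forall x, f x = g x} & \int[mu]_x g x = 0].
Proof.
move=> [f2 f0]; have mf := Lfun_measurable f2.
have fi := Lfun2_integrable muT f2.
have := ess_sup_ge mu (EFin \o f); have := ess_inf_le mu (EFin \o f).
have := ess_inf_le0 fi f0; have := ess_sup_ge0 fi f0; rewrite /osc.
case: (ess_sup _ _) => [s| |] //; case: (ess_inf _ _) => [i| |] //.
rewrite !lee_fin => s0 i0 fge fle _.
have b0 : 0 <= s - i by lra.
pose g x := Num.max (- (s - i)) (Num.min (s - i) (f x)).
have mg : measurable_fun setT g.
  by apply: measurable_maxr => //; exact: measurable_minr.
have fg : {ae mu, forall x, f x = g x}.
  apply: filterS2 fge fle => x /=; rewrite !lee_fin => ix sx.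
  by rewrite /g min_r ?max_r//; lra.
exists (s - i), g; split => //; split; first by rewrite EFinB.
split => //.
- move=> x; rewrite ler_norml /g le_max lexx/= ge_max ge_min lexx/= andbT.
  by rewrite ge0_cp.
- by rewrite -(ae_eq_Rintegral mf mg fg).
Qed.

Lemma sqnorm2E f g : measurable_fun setT f -> bounded_mfun g ->
  {ae mu, forall x, f x = g x} ->
  sqnorm2 mu f = (\int[mu]_x (g x ^+ 2))%:E.
Proof.
move=> mf bg fg; rewrite /sqnorm2 sqr_Lnorm2E fineK; last first.
  apply: integrable_fin_num => //; apply: (bounded_mfun_integrable muT).
  exact: bounded_mfunX.
apply: ae_eq_integral => //.
- exact/measurable_EFinP/measurable_funX.
- by apply/measurable_EFinP/measurable_funX; case: bg.
- by apply: filterS fg => x -> _.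
Qed.

Lemma oscy_WPI f (a : R) (r : R) : 0 < r -> ~ (osc mu f < +oo)%E ->
  (sqnorm2 mu f <= a%:E + r%:E * osc mu f ^+ 2)%E.
Proof.
move=> r0 /negP; rewrite -leNgt leye_eq => /eqP ->.
by rewrite expe2 mulyy gt0_muley ?lte_fin// addey// leey.
Qed.

End oscillation.

(** * Compatibility with almost-everywhere equality *)

Section kernel_ae.
Context d (E : measurableType d) (R : realType).
Variables (mu : probability E R) (T : R.-pker E ~> E).
Hypothesis Tinv : kernel_invariant mu T.

Local Notation K := (kernel_op T).

Lemma dirichlet_ae_eq (f g : E -> R) :
  measurable_fun setT f -> measurable_fun setT g ->
  {ae mu, forall x, f x = g x} -> dirichlet mu K f = dirichlet mu K g.
Proof.
move=> mf mg fg; have mKf := measurable_kernel_op T mf.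
have mKg := measurable_kernel_op T mg.
apply: ae_eq_Rintegral.
- by apply: measurable_funM => //; exact: measurable_funB.
- by apply: measurable_funM => //; exact: measurable_funB.
- by apply: filterS2 fg (kernel_op_ae_eq Tinv mf mg fg) => x /= -> ->.
Qed.

Lemma iter_kernel_op_ae_eq (f g : E -> R) n :
  measurable_fun setT f -> measurable_fun setT g ->
  {ae mu, forall x, f x = g x} ->
  measurable_fun setT (iter n K f) /\
  {ae mu, forall x, iter n K f x = iter n K g x}.
Proof.
move=> mf mg fg.
have miter h : measurable_fun setT h -> measurable_fun setT (iter n K h).
  by move=> mh; elim: n => //= m; exact: measurable_kernel_op.
split; first exact: miter.
elim: n miter => //= n ih miter.
have mK h : measurable_fun setT h -> measurable_fun setT (iter n K h).
  by move=> mh; elim: n {ih miter} => //= m; exact: measurable_kernel_op.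
by apply: kernel_op_ae_eq => //; [exact: mK|exact: mK|exact: ih].
Qed.

End kernel_ae.

(** * Existence of the adjoint *)

Section weighted_mixture.
Context d d' (E : measurableType d) (F : measurableType d') (R : realType).
Variables (mu : {measure set E -> \bar R}) (k : R.-pker E ~> F) (w : E -> R).
Local Open Scope ereal_scope.

(* The proofs [w0] and [wi] are arguments so that the measure and finite
   measure instances below can be inferred. *)
Definition weighted_mixture (w0 : forall x, (0 <= w x)%R)
  (wi : mu.-integrable setT (EFin \o w)) (A : set F) :=
  \int[mu]_x ((w x)%:E * k x A).

Hypothesis w0 : forall x, (0 <= w x)%R.
Hypothesis wi : mu.-integrable setT (EFin \o w).
Local Notation nu := (weighted_mixture w0 wi).

Let nu0 : nu set0 = 0.
Proof. by apply: integral0_eq => x _; rewrite measure0 mule0. Qed.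

Let nu_ge0 A : 0 <= nu A.
Proof. by apply: integral_ge0 => x _; rewrite mule_ge0// lee_fin. Qed.

Let nu_sigma_additive : semi_sigma_additive nu.
Proof.
move=> A mA tA mUA; have wk0 x n : 0 <= (w x)%:E * k x (A n).
  by rewrite mule_ge0// lee_fin.
have -> : nu (\bigcup_n A n) = \sum_(0 <= n <oo) nu (A n).
  rewrite -integral_nneseries//; last first.
    move=> n; apply: emeasurable_funM; first exact: measurable_int wi.
    exact: measurable_kernel.
  apply: eq_integral => x _; rewrite measure_bigcup//.
  rewrite nneseriesZl; last by move=> n _; exact: measure_ge0.
  by congr (_ * _); apply: eq_eseriesl => n; rewrite in_setT.
by apply: is_cvg_ereal_nneg_natsum_cond => n _ _; exact: nu_ge0.
Qed.

HB.instance Definition _ :=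
  isMeasure.Build _ _ _ nu nu0 nu_ge0 nu_sigma_additive.

Let nu_finite : fin_num_fun nu.
Proof.
apply: lty_fin_num_fun; rewrite /= /weighted_mixture.
under eq_integral do rewrite prob_kernel mule1.
exact: integrable_lty wi.
Qed.

HB.instance Definition _ := @Measure_isFinite.Build _ _ _ nu nu_finite.

End weighted_mixture.

Lemma maxr0_posneg (R : realDomainType) (a : R) :
  a = Num.max a 0 - Num.max (- a) 0.
Proof.
have [a0|a0] := leP a 0; first by rewrite max_l ?oppr_ge0// sub0r opprK.
by rewrite max_r ?oppr_le0 ?subr0// ltW.
Qed.

Section Lfun2_closure.
Context d (E : measurableType d) (R : realType) (mu : {measure set E -> \bar R}).
Implicit Types f g : E -> R.

Lemma Lfun2_le f g : measurable_fun setT f -> g \in Lfun mu 2%:E ->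
  (forall x, `|f x| <= `|g x|) -> f \in Lfun mu 2%:E.
Proof.
move=> mf /LfunP2[mg gi] fg; apply/LfunP2; split => //; apply: le_lt_trans gi.
apply: ge0_le_integral => //.
- by move=> x _; rewrite lee_fin sqr_ge0.
- exact/measurable_EFinP/measurable_funX.
- exact/measurable_EFinP/measurable_funX.
- move=> x _; rewrite lee_fin -(real_normK (num_real (f x))).
  by rewrite -(real_normK (num_real (g x))) lerXn2r ?nnegrE.
Qed.

Lemma Lfun2N f : f \in Lfun mu 2%:E -> (fun x => - f x) \in Lfun mu 2%:E.
Proof.
move=> f2; apply: (Lfun2_le _ f2) => [|x]; last by rewrite normrN.
exact/measurable_funN/(Lfun_measurable f2).
Qed.

Lemma Lfun2B f g : f \in Lfun mu 2%:E -> g \in Lfun mu 2%:E ->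
  (fun x => f x - g x) \in Lfun mu 2%:E.
Proof.
move=> f2 g2; have mf := Lfun_measurable f2; have mg := Lfun_measurable g2.
apply/LfunP2; split; first exact: measurable_funB.
have : mu.-integrable setT (fun x => (f x ^+ 2)%:E + (g x ^+ 2)%:E)%E.
  by apply: integrableD => //; exact: Lfun2_integrable_sqr.
move=> /(integrableZl measurableT 2) /(integrable_lty measurableT).
apply: le_lt_trans; apply: ge0_le_integral => //.
- by move=> x _; rewrite lee_fin sqr_ge0.
- exact/measurable_EFinP/measurable_funX/measurable_funB.
- apply: measurable_funeM; apply: emeasurable_funD;
    exact/measurable_EFinP/measurable_funX.
- move=> x _; rewrite -EFinD -EFinM lee_fin.
  by have := sqr_ge0 (f x + g x); nra.
Qed.

Lemma Lfun2_maxr f : f \in Lfun mu 2%:E ->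
  (fun x => Num.max (f x) 0) \in Lfun mu 2%:E.
Proof.
move=> f2; apply: (Lfun2_le _ f2) => [|x].
  by apply: measurable_maxr => //; exact: Lfun_measurable f2.
by have [] := leP (f x) 0; rewrite ?normr0.
Qed.

Lemma Rintegral_mulrBl f g h : f \in Lfun mu 2%:E -> g \in Lfun mu 2%:E ->
  h \in Lfun mu 2%:E ->
  \int[mu]_x ((f x - g x) * h x) =
  \int[mu]_x (f x * h x) - \int[mu]_x (g x * h x).
Proof.
move=> f2 g2 h2; under eq_Rintegral do rewrite mulrBl.
by rewrite RintegralB//; exact: Lfun2_integrable_mul.
Qed.

End Lfun2_closure.

Section adjoint.
Context d (E : measurableType d) (R : realType).
Variables (mu : probability E R) (T : R.-pker E ~> E).
Hypothesis Tinv : kernel_invariant mu T.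
Local Notation K := (kernel_op T).
Implicit Types f g h : E -> R.

Let muT : mu setT = 1%E. Proof. exact: probability_setT. Qed.

(* [h] is the density of [A |-> \int g(x) T(x, A) mu(dx)] with respect to [mu]. *)
Lemma kernel_adjoint_density g : g \in Lfun mu 2%:E -> (forall x, 0 <= g x) ->
  exists h, [/\ measurable_fun setT h, forall x, 0 <= h x &
    forall f : E -> \bar R, (forall x, 0 <= f x)%E -> measurable_fun setT f ->
    (\int[mu]_x ((g x)%:E * \int[T x]_y f y) = \int[mu]_x (f x * (h x)%:E))%E].
Proof.
move=> g2 g0; have gi := Lfun2_integrable muT g2.
have mg := Lfun_measurable g2.
pose nu : {finite_measure set E -> \bar R} := weighted_mixture T g0 gi.
(* By invariance a [mu]-null set is [T x]-null for almost every [x], which gives the absolute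
   continuity required by Radon-Nikodym. *)
have numu : nu `<< mu.
  apply/null_content_dominatesP => A mA A0.
  have : {ae mu, forall x, T x A = 0%E}.
    have : (\int[mu]_x `|T x A| = 0)%E.
      by under eq_integral do rewrite gee0_abs//; rewrite Tinv.
    move/(ae_eq_integral_abs mu measurableT (measurable_kernel T A mA)).
    by apply: filterS => x /(_ I).
  move=> TA0; rewrite /nu/= /weighted_mixture.
  rewrite (ae_eq_integral (cst 0%E)) ?integral0//.
  - apply: emeasurable_funM; first exact/measurable_EFinP.
    exact: measurable_kernel.
  - by apply: filterS TA0 => x -> _; rewrite mule0.
pose phi := Radon_Nikodym_SigmaFinite.f nu mu.
have phi0 := Radon_Nikodym_SigmaFinite.f_ge0 numu.
have phif := Radon_Nikodym_SigmaFinite.f_fin_num numu.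
exists (fine \o phi); split.
- by apply: measurableT_comp => //;
    exact: measurable_int (Radon_Nikodym_SigmaFinite.f_integrable numu).
- by move=> x /=; rewrite fine_ge0// phi0.
- move=> f f0 mf.
  rewrite -(@ge0_integral_mixture _ _ _ _ _ mu T g nu)//.
  rewrite -(Radon_Nikodym_SigmaFinite.change_of_variables numu f0 measurableT mf).
  by apply: eq_integral => x _ /=; rewrite fineK// phif.
Qed.

End adjoint.

Section adjoint_existence.
Context d (E : measurableType d) (R : realType).
Variables (mu : probability E R) (T : R.-pker E ~> E).
Hypothesis Tinv : kernel_invariant mu T.
Local Notation K := (kernel_op T).
Implicit Types f g h : E -> R.

Let muT : mu setT = 1%E. Proof. exact: probability_setT. Qed.

Let TT x : T x setT = 1%E. Proof. exact: prob_kernel. Qed.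

(* Testing the duality against the truncations [t] of [h] gives
   [||t||^2 <= <h, t> = <g, T t> <= (||g||^2 + ||t||^2) / 2]. *)
Lemma kernel_adjoint_density_Lfun2 g h :
  g \in Lfun mu 2%:E -> (forall x, 0 <= g x) ->
  measurable_fun setT h -> (forall x, 0 <= h x) ->
  (forall f : E -> \bar R, (forall x, 0 <= f x)%E -> measurable_fun setT f ->
    (\int[mu]_x ((g x)%:E * \int[T x]_y f y) = \int[mu]_x (f x * (h x)%:E))%E) ->
  h \in Lfun mu 2%:E.
Proof.
move=> g2 g0 mh h0 hE; pose t n x := Num.min (h x) n%:R.
have t0 n x : 0 <= t n x by rewrite le_min h0/=.
have th n x : t n x <= h x by rewrite ge_min lexx.
have mt n : measurable_fun setT (t n) by exact: measurable_minr.
have bt n : bounded_mfun (t n).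
  by split => //; exists n%:R => x; rewrite ger0_norm// ge_min lexx orbT.
have bKt n := bounded_mfun_kernel_op T (bt n).
have Kt2 n : K (t n) \in Lfun mu 2%:E by exact: bounded_mfun_Lfun2.
have igK n := Lfun2_integrable_mul g2 (Kt2 n).
have ig2 := Lfun2_integrable_sqr g2.
have it2 n : mu.-integrable setT (EFin \o (fun x => t n x ^+ 2)).
  by apply: (bounded_mfun_integrable muT); exact: bounded_mfunX.
have iK2 n : mu.-integrable setT (EFin \o (fun x => K (t n) x ^+ 2)).
  by apply: (bounded_mfun_integrable muT); exact: bounded_mfunX.
have le1 n : \int[mu]_x (t n x ^+ 2) <= \int[mu]_x (g x * K (t n) x).
  rewrite -lee_fin /Rintegral fineK; last exact: integrable_fin_num (it2 n).
  rewrite fineK; last exact: integrable_fin_num (igK n).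
  rewrite [leRHS](eq_integral (fun x => (g x)%:E * \int[T x]_y (t n y)%:E)%E); last first.
    move=> x _; rewrite EFinM; congr (_ * _)%E.
    rewrite /kernel_op /Rintegral fineK//.
    exact: (integrable_fin_num measurableT (bounded_mfun_integrable (TT x) (bt n))).
  rewrite hE//; [|by move=> x; rewrite lee_fin|exact/measurable_EFinP].
  apply: ge0_le_integral => //.
  - by move=> x _; rewrite lee_fin sqr_ge0.
  - exact/measurable_EFinP/measurable_funX.
  - by apply: emeasurable_funM; exact/measurable_EFinP.
  - by move=> x _; rewrite -EFinM lee_fin expr2 ler_wpM2l.
have le2 n : \int[mu]_x (t n x ^+ 2) <= \int[mu]_x (g x ^+ 2).
  have : \int[mu]_x (2 * (g x * K (t n) x)) <=
      \int[mu]_x (g x ^+ 2 + K (t n) x ^+ 2).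
    apply: le_Rintegral => //.
    - exact: (integrableZl measurableT 2 (igK n)).
    - exact: (integrableD measurableT ig2 (iK2 n)).
    - by move=> x _; have := sqr_ge0 (g x - K (t n) x); nra.
  rewrite RintegralZl// RintegralD//.
  by have := sqr_kernel_op_le Tinv (bt n); have := le1 n; lra.
apply/LfunP2; split => //.
apply: (@le_lt_trans _ _ (\int[mu]_x (g x ^+ 2))%:E); last exact: ltry.
have lim : (\int[mu]_x (t n x ^+ 2)%:E @[n --> \oo] --> \int[mu]_x (h x ^+ 2)%:E)%E.
  apply: nd_ge0_cvg_integral.
  - by move=> n; exact/measurable_EFinP/measurable_funX.
  - by move=> n x; rewrite lee_fin sqr_ge0.
  - move=> x m n mn; rewrite lee_fin lerXn2r ?nnegrE// le_min ge_min lexx/=.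
    by rewrite ge_min ler_nat mn orbT.
  - move=> x; apply: cvg_near_cst; near=> n.
    rewrite /t min_l//; near: n; exact: nbhs_infty_ger.
apply: (cvge_to_le lim); apply: nearW => n.
have := le2 n; rewrite -lee_fin; apply: le_trans.
by rewrite /Rintegral fineK//; exact: (integrable_fin_num measurableT (it2 n)).
Unshelve. all: by end_near. Qed.

(** By invariance the extended integral of [f] under [T x] is finite for almost every [x]; there
    [K f x] is its true value and not a default. *)
Lemma integral_mul_kernel_op f g : f \in Lfun mu 2%:E -> (forall x, 0 <= f x) ->
  measurable_fun setT g ->
  (\int[mu]_x (K f x * g x)%:E =
   \int[mu]_x ((g x)%:E * \int[T x]_y (f y)%:E))%E.
Proof.
move=> f2 f0 mg; have mf := Lfun_measurable f2.
have mfE : measurable_fun setT (EFin \o f) by exact/measurable_EFinP.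
have f0E x : (0 <= (EFin \o f) x)%E by rewrite lee_fin.
have mTf := ge0_measurable_kernel_integral T f0E mfE.
have Tf0 x : (0 <= \int[T x]_y (f y)%:E)%E by apply: integral_ge0 => y _; exact: f0E.
have iT : mu.-integrable setT (fun x => \int[T x]_y (f y)%:E)%E.
  apply/integrableP; split => //.
  under eq_integral do rewrite gee0_abs//.
  rewrite ge0_integral_invariant//.
  exact: integrable_lty (Lfun2_integrable muT f2).
apply: ae_eq_integral => //.
- by apply/measurable_EFinP/measurable_funM => //; exact: measurable_kernel_op.
- by apply: emeasurable_funM => //; exact/measurable_EFinP.
- apply: filterS (integrable_ae measurableT iT) => x /(_ I) fin _.
  by rewrite EFinM muleC /kernel_op /Rintegral fineK.
Qed.

(** Linearity holds only where [f] is [T x]-integrable. Invariance applied to [f^2] puts [f] in the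
    L2 space of [T x] for almost every [x]. *)
Lemma kernel_op_posneg f : f \in Lfun mu 2%:E ->
  {ae mu, forall x, K f x =
    K (fun y => Num.max (f y) 0) x - K (fun y => Num.max (- f y) 0) x}.
Proof.
move=> f2; have mf := Lfun_measurable f2.
have [mf2 f2i] := (LfunP2 mu f).1 f2.
have m2 : measurable_fun setT (fun x => (f x ^+ 2)%:E).
  exact/measurable_EFinP/measurable_funX.
have f20 x : (0 <= (f x ^+ 2)%:E)%E by rewrite lee_fin sqr_ge0.
have : {ae mu, forall x, f \in Lfun (T x) 2%:E}.
  have Tf0 x : (0 <= \int[T x]_y (f y ^+ 2)%:E)%E by exact: integral_ge0.
  have iT : mu.-integrable setT (fun x => \int[T x]_y (f y ^+ 2)%:E)%E.
    apply/integrableP; split; first exact: ge0_measurable_kernel_integral.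
    under eq_integral do rewrite gee0_abs//.
    by rewrite ge0_integral_invariant.
  apply: filterS (integrable_ae measurableT iT) => x /(_ I) fin.
  by apply/LfunP2; split => //; rewrite ltey_eq fin.
apply: filterS => x fx2; rewrite /kernel_op.
have fN2 := Lfun2N fx2.
rewrite -RintegralB//; try by apply: (Lfun2_integrable (TT x)); exact: Lfun2_maxr.
by apply: eq_Rintegral => y _; exact: maxr0_posneg.
Qed.

(** For non-negative [f] this is the density identity; a general [f] is split into its positive and
    negative parts. *)
Lemma kernel_adjoint_ge0 g : g \in Lfun mu 2%:E -> (forall x, 0 <= g x) ->
  exists2 h, h \in Lfun mu 2%:E & forall f, f \in Lfun mu 2%:E ->
    inner2 mu (K f) g = inner2 mu f h.
Proof.
move=> g2 g0; have [h [mh h0 hE]] := kernel_adjoint_density Tinv g2 g0.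
have h2 := kernel_adjoint_density_Lfun2 g2 g0 mh h0 hE.
have mg := Lfun_measurable g2.
have pos f : f \in Lfun mu 2%:E -> (forall x, 0 <= f x) ->
    inner2 mu (K f) g = inner2 mu f h.
  move=> f2 f0; congr fine; rewrite integral_mul_kernel_op//.
  rewrite hE; last exact/measurable_EFinP/(Lfun_measurable f2).
    by apply: eq_integral => x _; rewrite EFinM.
  by move=> x; rewrite lee_fin.
exists h => // f f2; have mf := Lfun_measurable f2.
have fN2 := Lfun2N f2.
pose fp x := Num.max (f x) 0; pose fn x := Num.max (- f x) 0.
have fp2 : fp \in Lfun mu 2%:E by exact: Lfun2_maxr.
have fn2 : fn \in Lfun mu 2%:E by exact: Lfun2_maxr.
have fE x : f x = fp x - fn x by exact: maxr0_posneg.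
have Kfp2 := kernel_op_Lfun2 Tinv fp2; have Kfn2 := kernel_op_Lfun2 Tinv fn2.
have fp0 x : 0 <= fp x by rewrite le_max lexx orbT.
have fn0 x : 0 <= fn x by rewrite le_max lexx orbT.
transitivity (\int[mu]_x ((K fp x - K fn x) * g x)).
  apply: ae_eq_Rintegral.
  - by apply: measurable_funM => //; exact: measurable_kernel_op.
  - apply: measurable_funM => //; apply: measurable_funB.
      exact: Lfun_measurable Kfp2.
    exact: Lfun_measurable Kfn2.
  - by apply: filterS (kernel_op_posneg f2) => x ->.
rewrite Rintegral_mulrBl// -/(inner2 mu (K fp) g) -/(inner2 mu (K fn) g) !pos//.
rewrite /inner2 -Rintegral_mulrBl//.
by apply: eq_Rintegral => x _; rewrite -fE.
Qed.

Lemma kernel_op_adjoint_at g : g \in Lfun mu 2%:E ->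
  exists2 h, h \in Lfun mu 2%:E & forall f, f \in Lfun mu 2%:E ->
    inner2 mu (K f) g = inner2 mu f h.
Proof.
move=> g2; have mg := Lfun_measurable g2.
have gN2 := Lfun2N g2.
pose gp x := Num.max (g x) 0; pose gn x := Num.max (- g x) 0.
have gp2 : gp \in Lfun mu 2%:E by exact: Lfun2_maxr.
have gn2 : gn \in Lfun mu 2%:E by exact: Lfun2_maxr.
have gE x : g x = gp x - gn x by exact: maxr0_posneg.
have [hp hp2 hpE] : exists2 h, h \in Lfun mu 2%:E & forall f, f \in Lfun mu 2%:E ->
    inner2 mu (K f) gp = inner2 mu f h.
  by apply: kernel_adjoint_ge0 => // x; rewrite le_max lexx orbT.
have [hn hn2 hnE] : exists2 h, h \in Lfun mu 2%:E & forall f, f \in Lfun mu 2%:E ->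
    inner2 mu (K f) gn = inner2 mu f h.
  by apply: kernel_adjoint_ge0 => // x; rewrite le_max lexx orbT.
exists (fun x => hp x - hn x); first exact: Lfun2B.
move=> f f2; have Kf2 := kernel_op_Lfun2 Tinv f2.
rewrite /inner2; under eq_Rintegral do rewrite gE mulrC.
under [RHS]eq_Rintegral do rewrite mulrC.
rewrite !Rintegral_mulrBl//.
by congr (_ - _); under eq_Rintegral do rewrite mulrC;
  under [RHS]eq_Rintegral do rewrite mulrC; [exact: hpE|exact: hnE].
Qed.

(** [get] returns an arbitrary default unless some adjoint exists. One is assembled by choice from
    the values at each [g], with [g] itself as a dummy value outside L2. *)
Lemma kernel_op_adjointP : is_adjoint mu K (adjoint mu K).
Proof.
rewrite /adjoint.
have /choice[S SE] : forall g, exists h, g \in Lfun mu 2%:E ->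
    h \in Lfun mu 2%:E /\ forall f, f \in Lfun mu 2%:E ->
      inner2 mu (K f) g = inner2 mu f h.
  move=> g; have [g2|g2] := boolP (g \in Lfun mu 2%:E); last by exists g.
  by have [h h2 hE] := kernel_op_adjoint_at g2; exists h.
apply: (@getPex _ [set S' | is_adjoint mu K S']); exists S; split.
- by move=> g /SE[].
- by move=> f g f2 /SE[_]; apply.
Qed.

(** Since [<T^* T f, f> = ||T f||^2], the energy is the squared norm lost in one application of
    [T]. *)
Lemma dirichlet_adjoint f : f \in Lfun mu 2%:E ->
  dirichlet mu (adjoint mu K \o K) f =
  \int[mu]_x (f x ^+ 2) - \int[mu]_x (K f x ^+ 2).
Proof.
move=> f2; have [A2 AE] := kernel_op_adjointP.
have Kf2 := kernel_op_Lfun2 Tinv f2.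
rewrite /dirichlet /inner2 Rintegral_mulrBl//; last exact: A2.
congr (_ - _); under eq_Rintegral do rewrite mulrC.
exact/esym/(AE _ _ f2 Kf2).
Qed.

End adjoint_existence.

(** * From bounded functions to mean-zero square-integrable ones *)

Section bounded_to_L20.
Context d (E : measurableType d) (R : realType).
Variables (mu : probability E R) (T : R.-pker E ~> E).
Hypothesis Tinv : kernel_invariant mu T.
Local Notation K := (kernel_op T).

(** Common route for [T] and [T^* T]. Non-negativity of the Dirichlet form allows the constant to be
    enlarged when the rate is made monotone; an infinite oscillation makes the inequality
    trivial. *)
Lemma osc_WPI_of_bounded (S : (E -> R) -> (E -> R)) :
  (forall f g, f \in Lfun mu 2%:E -> bounded_mfun g ->
    {ae mu, forall x, f x = g x} -> dirichlet mu S f = dirichlet mu S g) ->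
  (forall g, bounded_mfun g -> 0 <= dirichlet mu S g) ->
  (forall r : R, 0 < r -> exists2 C : R, 0 <= C &
    forall (f : E -> R) (b : R), measurable_fun setT f ->
      (forall x, `|f x| <= b) -> \int[mu]_x f x = 0 -> 0 <= b ->
      \int[mu]_x (f x ^+ 2) <= C * dirichlet mu S f + r * b ^+ 2) ->
  osc_WPI mu S.
Proof.
move=> Sae S0 /exists_nonincreasing_rate[].
- move=> r s C rs H f b mf fb f0 b0; rewrite (le_trans (H f b mf fb f0 b0))//.
  by rewrite lerD2l ler_wpM2r// sqr_ge0.
- move=> r C D CD H f b mf fb f0 b0; rewrite (le_trans (H f b mf fb f0 b0))//.
  by rewrite lerD2r ler_wpM2r// S0//; split => //; exists b.
move=> alpha [alpha0 alpha_le alphaE]; exists alpha; split => // r f r0 Lf.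
have [oscf|] := pselect (osc mu f < +oo)%E; last exact: oscy_WPI.
have [b [g [b0 [-> [mg gb fg g0]]]]] := L20_bounded_representative Lf oscf.
have bg : bounded_mfun g by split => //; exists b.
have mf : measurable_fun setT f := Lfun_measurable Lf.1.
rewrite (sqnorm2E mf bg fg) (Sae _ _ Lf.1 bg fg) expe2 -!EFinM -EFinD lee_fin.
by rewrite -expr2; exact: alphaE.
Qed.

Lemma osc_WPI_kernel_op : kernel_irreducible mu T -> osc_WPI mu K.
Proof.
move=> Tirr; apply: osc_WPI_of_bounded.
- by move=> f g f2 [mg _]; apply: dirichlet_ae_eq => //; exact: Lfun_measurable f2.
- by move=> g; exact: dirichlet_kernel_op_ge0.
- by move=> r; exact: weak_poincare_bounded.
Qed.

Hypothesis Tirr : kernel_irreducible mu T.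
Variable c : R.
Hypotheses (c0 : 0 < c) (m1 : forall x : E, measurable [set x]).
Hypothesis cT : {ae mu, forall x, (c%:E <= T x [set x])%E}.

Lemma drop_inequality (r : R) : 0 < r -> exists2 C : R, 1 <= C &
  forall (f : E -> R) (b : R), measurable_fun setT f ->
    (forall x, `|f x| <= b) -> \int[mu]_x f x = 0 -> 0 <= b ->
    \int[mu]_x (f x ^+ 2) <=
      C * (\int[mu]_x (f x ^+ 2) - \int[mu]_x (K f x ^+ 2)) + r * b ^+ 2.
Proof.
move=> r0; have [C C0 CE] := weak_poincare_bounded Tinv Tirr r0.
have c10 : 0 <= C / 2 * (1 + c^-1).
  by rewrite mulr_ge0 ?divr_ge0// addr_ge0// invr_ge0 ltW.
(* The half offsets the factor 2 in [energy_drop]. The added 1 makes the constant at least 1, as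
   [geometric_decay] requires, and only enlarges the bound because the drop is non-negative. *)
exists (C / 2 * (1 + c^-1) + 1) => [|f b mf fb f0 b0]; first by rewrite lerDr.
have bf : bounded_mfun f by split => //; exists b.
rewrite (le_trans (CE f b mf fb f0 b0))// lerD2r.
have := energy_drop Tinv c0 m1 cT bf; have := sqr_kernel_op_le Tinv bf.
rewrite -subr_ge0; set D := dirichlet _ _ _; set u := _ - _ => u0 Du.
have := ler_wpM2l (divr_ge0 C0 (ler0n R 2)) Du.
rewrite [leRHS]mulrA (_ : C / 2 * (2 * D) = C * D); last by field.
by move=> /le_trans; apply; rewrite [leRHS]mulrDl mul1r lerDl.
Qed.

Lemma osc_WPI_adjoint : osc_WPI mu (adjoint mu K \o K).
Proof.
apply: osc_WPI_of_bounded.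
- move=> f g f2 bg fg; have [mg _] := bg; have mf := Lfun_measurable f2.
  have g2 : g \in Lfun mu 2%:E by apply: bounded_mfun_Lfun2 => //; exact: probability_setT.
  rewrite !dirichlet_adjoint//; congr (_ - _); apply: ae_eq_Rintegral;
    try (apply: measurable_funX => //; exact: measurable_kernel_op).
  + by apply: filterS fg => x ->.
  + by apply: filterS (kernel_op_ae_eq Tinv mf mg fg) => x ->.
- move=> g bg; rewrite dirichlet_adjoint//.
    by rewrite subr_ge0; exact: sqr_kernel_op_le.
  by apply: bounded_mfun_Lfun2 => //; exact: probability_setT.
- move=> r r0; have [C C1 CE] := drop_inequality r0.
  exists C; first exact: le_trans C1.
  move=> f b mf fb f0 b0; rewrite dirichlet_adjoint//; first exact: CE.
  apply: bounded_mfun_Lfun2; first exact: probability_setT.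
  by split => //; exists b.
Qed.

Lemma osc_convergent_kernel_op : osc_convergent mu K.
Proof.
pose Q n (C : R) := forall (f : E -> R) (b : R), measurable_fun setT f ->
  (forall x, `|f x| <= b) -> \int[mu]_x f x = 0 -> 0 <= b ->
  \int[mu]_x (iter n K f x ^+ 2) <= C * b ^+ 2.
have [||||gamma [gamma0 gamma_le gamma_cvg gammaE]] :=
  @exists_vanishing_rate R Q.
- by exists 1 => // f b mf fb _ b0; rewrite mul1r; exact: Rintegral_sqr_le.
(* A bound at time [m] persists because [T] contracts the second moment. *)
- move=> m n C /subnK <- Qm f b mf fb f0 b0.
  elim: (n - m)%N => [|k ih]; first exact: Qm.
  apply: le_trans ih; rewrite addSn/=; apply: sqr_kernel_op_le => //.
  have [mk kb _] := iter_kernel_op Tinv (k + m) mf fb f0.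
  by split => //; exists b.
- move=> n C D CD QC f b mf fb f0 b0.
  by rewrite (le_trans (QC f b mf fb f0 b0))// ler_wpM2r// sqr_ge0.
(* Half of [e] is the remainder [r]; the other half bounds the geometric term for some large [n]. *)
- move=> e e0; have e20 : 0 < e / 2 by rewrite divr_gt0.
  have [C C1 CE] := drop_inequality e20.
  have C0 : 0 < C by exact: lt_le_trans C1.
  have q1 : `|1 - C^-1| < 1.
    rewrite ger0_norm ?subr_ge0 ?invf_le1//.
    by rewrite ltrBlDr ltrDl invr_gt0.
  have /cvgrPdist_le /(_ _ e20)[n _ /(_ n (leqnn n))] := cvg_expr q1.
  rewrite /= sub0r normrN => qn; exists n => f b mf fb f0 b0.
  apply: le_trans (geometric_decay Tinv C1 CE n (ltW e20) mf fb f0 b0) _.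
  rewrite ler_wpM2r ?sqr_ge0// [leRHS]splitr lerD2r.
  exact: le_trans (ler_norm _) qn.
exists gamma; split => // [n|n f Lf]; first exact: ltW.
have mf : measurable_fun setT f := Lfun_measurable Lf.1.
have [oscf|/negP] := pselect (osc mu f < +oo)%E; last first.
  rewrite -leNgt leye_eq => /eqP ->.
  by rewrite expe2 mulyy gt0_muley ?lte_fin// leey.
have [b [g [b0 [-> [mg gb fg g0]]]]] := L20_bounded_representative Lf oscf.
have [mif ifg] := iter_kernel_op_ae_eq Tinv n mf mg fg.
have [mig igb _] := iter_kernel_op Tinv n mg gb g0.
rewrite (sqnorm2E mif _ ifg); last by split => //; exists b.
by rewrite expe2 -!EFinM lee_fin -expr2; exact: gammaE.
Qed.

End bounded_to_L20.

Theorem corollary63 (d : measure_display) (E : measurableType d) (R : realType)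
    (mu : probability E R) (T : R.-pker E ~> E)
    (mdiag : measurable [set p : E * E | p.1 = p.2])
    (Tinv : kernel_invariant mu T)
    (Tirr : kernel_irreducible mu T) :
  osc_WPI mu (kernel_op T) /\
  ((0 < ess_inf mu (fun x => T x [set x]))%E ->
   osc_WPI mu (adjoint mu (kernel_op T) \o kernel_op T) /\
   osc_convergent mu (kernel_op T)).
Proof.
split; first exact: osc_WPI_kernel_op.
move=> hold.
(* Singletons are sections of the measurable diagonal. *)
have m1 (x : E) : measurable [set x].
  rewrite (_ : [set x] = xsection [set p : E * E | p.1 = p.2] x).
    exact: measurable_xsection.
  by apply/seteqP; split => y; rewrite /xsection /= inE /=.
(* A real essential infimum serves as [c] itself; the formal value [+oo] is covered by [c = 1]. *)
have [c c0 cT] : exists2 c : R, 0 < c &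
    {ae mu, forall x, (c%:E <= T x [set x])%E}.
  have := ess_inf_le mu (fun x => T x [set x]).
  case: (ess_inf _ _) hold => [c| |] //.
    by rewrite lte_fin => c0 cT; exists c.
  move=> _ yT; exists 1 => //; apply: filterS yT => x.
  by apply: le_trans; rewrite leey.
split; first exact: (osc_WPI_adjoint Tinv Tirr c0 m1 cT).
exact: (osc_convergent_kernel_op Tinv Tirr c0 m1 cT).
Qed.
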